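(* Let $\mathbb{F}$ be a field, let $P \subseteq \mathbb{F}^2$ be a set of $n$ points such that no $s$ points of $P$ are collinear, and let $\alpha,\beta \in \mathbb{F} \setminus \{0\}$. Then \[|\Pi_{\alpha,\beta}(P)| < \min(2s^2n,\ 4n^2).\]
   Context: For a field $\mathbb{F}$, a finite set $P \subseteq \mathbb{F}^d$ and $\alpha,\beta \in \mathbb{F}$, define $\Pi_{\alpha,\beta}(P) = \{(p,q,r) \in P \times P \times P \mid p \cdot q = \alpha,\ p \cdot r = \beta\}$, where $x\cdot y=\sum_i x_iy_i$ is the standard dot product. ''No $s$ points of $P$ are collinear'' means that every line contains fewer than $s$ points of $P$. *)

(* Defs.v *)
From mathcomp Require Import all_boot all_order all_algebra finmap.
Set Implicit Arguments.
Unset Strict Implicit.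
Unset Printing Implicit Defensive.
Import GRing.Theory.
Local Open Scope fset_scope.
Local Open Scope ring_scope.

Definition dot (F : fieldType) (d : nat) (x y : 'rV[F]_d) : F :=
  \sum_(i < d) x 0 i * y 0 i.

Definition Pi_set (F : fieldType) (d : nat) (alpha beta : F)
    (P : {fset 'rV[F]_d}) : {fset 'rV[F]_d * 'rV[F]_d * 'rV[F]_d} :=
  [fset t in P `*` P `*` P
     | (dot t.1.1 t.1.2 == alpha) && (dot t.1.1 t.2 == beta)].

(* For v != 0, the points x satisfying on_line a v x form the line through a
   with direction v; the boolean test says that x - a is in the span of v. *)
Definition on_line (F : fieldType) (d : nat) (a v x : 'rV[F]_d) : bool :=
  (x - a <= v)%MS.

Lemma on_lineP (F : fieldType) (d : nat) (a v x : 'rV[F]_d) :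
  reflect (exists t : F, x = a + t *: v) (on_line a v x).
Proof.
apply: (iffP sub_rVP) => -[t tE]; exists t.
  by rewrite -tE addrC subrK.
by rewrite tE addrAC subrr add0r.
Qed.

Definition no_collinear (F : fieldType) (d s : nat) (P : {fset 'rV[F]_d}) : Prop :=
  forall a v : 'rV[F]_d, v != 0 -> (#|` [fset x in P | on_line a v x]| < s)%N.

(* Main.v *)
(** The bound in [s]: given [p], the points [q] with [p . q = alpha] lie on a
    line, since [alpha != 0] forces [p != 0]; likewise for [r].  The bound in
    [n]: if [q] and [r] are independent then [p] is determined by [(q, r)]; if
    they are dependent then [q = (alpha / beta) r] is determined by [r], hence
    the triple by [(p, r)].  So there are at most [2 n ^ 2] triples. *)

Require Import Defs.
From mathcomp Require Import all_boot all_order all_algebra finmap.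
From mathcomp Require Import ring zify.
Set Implicit Arguments.
Unset Strict Implicit.
Local Open Scope fset_scope.
Local Open Scope ring_scope.

Import GRing.Theory.

Lemma card_fset_le_image (T : choiceType) (U : eqType) (A : {fset T})
    (f : T -> U) (s : seq U) :
  {in A &, injective f} -> {in A, forall x, f x \in s} -> (#|` A| <= size s)%N.
Proof.
move=> f_inj f_s; rewrite -(size_map f); apply: uniq_leq_size.
  by rewrite map_inj_in_uniq ?fset_uniq.
by move=> _ /mapP[x Ax ->]; apply: f_s.
Qed.

Lemma dot2E (F : fieldType) (x y : 'rV[F]_2) :
  dot x y = x 0 0 * y 0 0 + x 0 1 * y 0 1.
Proof.
by rewrite /dot big_ord_recl big_ord1; congr (_ + x 0 _ * y 0 _); apply/val_inj.
Qed.

Lemma rV2P (F : fieldType) (x y : 'rV[F]_2) :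
  x 0 0 = y 0 0 -> x 0 1 = y 0 1 -> x = y.
Proof.
move=> e0 e1; apply/rowP => -[[|[|//]] lti].
  by rewrite (_ : Ordinal lti = 0) //; apply/val_inj.
by rewrite (_ : Ordinal lti = 1) //; apply/val_inj.
Qed.

Definition det2 (F : fieldType) (x y : 'rV[F]_2) : F :=
  x 0 0 * y 0 1 - x 0 1 * y 0 0.

(* Cramer's rule *)
Lemma eq_of_dot (F : fieldType) (p p' q r : 'rV[F]_2) :
  det2 q r != 0 -> dot p q = dot p' q -> dot p r = dot p' r -> p = p'.
Proof.
rewrite !dot2E /det2 => D0 eq_q eq_r.
apply: rV2P; apply: (mulfI D0); apply/eqP; rewrite -subr_eq0; apply/eqP.
  (* Elimination of the second coordinate: [det2 q r * (p 0 0 - p' 0 0)] is [r 0 1] times the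
     difference for [q] minus [q 0 1] times the difference for [r]. The other coordinate is
     symmetric. *)
  transitivity (r 0 1 * (p 0 0 * q 0 0 + p 0 1 * q 0 1 - (p' 0 0 * q 0 0 + p' 0 1 * q 0 1))
    - q 0 1 * (p 0 0 * r 0 0 + p 0 1 * r 0 1 - (p' 0 0 * r 0 0 + p' 0 1 * r 0 1))).
    by ring.
  by rewrite eq_q eq_r !subrr !mulr0 subrr.
transitivity (q 0 0 * (p 0 0 * r 0 0 + p 0 1 * r 0 1 - (p' 0 0 * r 0 0 + p' 0 1 * r 0 1))
  - r 0 0 * (p 0 0 * q 0 0 + p 0 1 * q 0 1 - (p' 0 0 * q 0 0 + p' 0 1 * q 0 1))).
  by ring.
by rewrite eq_q eq_r !subrr !mulr0 subrr.
Qed.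

(** The difference of the two sides is [det2 q r] times the vector with coordinates [p 0 1] and
    [- p 0 0]. *)
Lemma dot_scale_of_det2_eq0 (F : fieldType) (p q r : 'rV[F]_2) :
  det2 q r = 0 -> dot p r *: q = dot p q *: r.
Proof.
rewrite !dot2E /det2 => D0; apply: rV2P; rewrite !mxE;
  apply/eqP; rewrite -subr_eq0; apply/eqP.
  by transitivity (p 0 1 * (q 0 0 * r 0 1 - q 0 1 * r 0 0)); [ring | rewrite D0 mulr0].
by transitivity (- p 0 0 * (q 0 0 * r 0 1 - q 0 1 * r 0 0)); [ring | rewrite D0 mulr0].
Qed.

(** The difference [x - a] is orthogonal to [p], and in the plane the vectors orthogonal to a
    nonzero [p] are the multiples of the quarter turn of [p]. *)
Lemma level_dot_on_line (F : fieldType) (p a x : 'rV[F]_2) :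
  p != 0 -> dot p x = dot p a ->
  on_line a (\row_(i < 2) if i == 0 then p 0 1 else - p 0 0) x.
Proof.
rewrite !dot2E => p0 eq_px.
(* The parameter on the line is read off in a coordinate where the direction does not vanish. *)
have [p00|p00] := eqVneq (p 0 0) 0.
  have p01 : p 0 1 != 0.
    by apply: contraNneq p0 => p01; apply/eqP/rV2P; rewrite ?p00 ?p01 mxE.
  apply/on_lineP; exists ((x 0 0 - a 0 0) / p 0 1); apply: rV2P; rewrite !mxE /=.
    by field.
  rewrite p00 oppr0 mulr0 addr0; apply: (mulfI p01).
  by move: eq_px; rewrite p00 !mul0r !add0r.
apply/on_lineP; exists (- (x 0 1 - a 0 1) / p 0 0); apply: rV2P; rewrite !mxE /=.
  apply: (mulfI p00); rewrite mulrDr; apply: (addIr (p 0 1 * x 0 1)).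
  by rewrite eq_px; field.
by field.
Qed.

Lemma card_level_dot_lt (F : fieldType) (s : nat) (P : {fset 'rV[F]_2})
    (p : 'rV[F]_2) (c : F) :
  no_collinear s P -> c != 0 -> (#|` [fset x in P | dot p x == c]| < s)%N.
Proof.
move=> collP c0; set L := [fset x in P | _].
have [->|[a]] := fset_0Vmem L.
  (* For empty [L] the claim is [0 < s], which [collP] yields for any line; the all-ones vector
     serves as a nonzero direction. *)
  have v0 : (const_mx 1 : 'rV[F]_2) != 0.
    by apply/eqP => /rowP/(_ 0)/eqP; rewrite !mxE oner_eq0.
  by rewrite cardfs0; apply: leq_ltn_trans (collP 0 _ v0).
rewrite !inE => /= /andP[_ /eqP pa].
have p0 : p != 0.
  by apply: contra_neq c0 => p0; rewrite -pa dot2E p0 !mxE !mul0r addr0.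
set v : 'rV[F]_2 := \row_(i < 2) if i == 0 then p 0 1 else - p 0 0.
have v0 : v != 0.
  apply: contraNneq p0 => /rowP v0.
  have := v0 0; have := v0 1; rewrite !mxE /= => /eqP; rewrite oppr_eq0 => /eqP e0 e1.
  by apply/eqP/rV2P; rewrite ?e0 ?e1 mxE.
apply: leq_ltn_trans (collP a v v0); apply: fsubset_leq_card.
apply/fsubsetP => x; rewrite !inE => /= /andP[-> /eqP px] /=.
by apply: level_dot_on_line; rewrite // px.
Qed.

Lemma card_Pi_set_le_lines (F : fieldType) (s : nat) (P : {fset 'rV[F]_2})
    (alpha beta : F) :
  no_collinear s P -> alpha != 0 -> beta != 0 ->
  (#|` Pi_set alpha beta P| <= s.-1 ^ 2 * #|` P|)%N.
Proof.
move=> collP a0 b0.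
pose L c p := [fset x in P | dot p x == c].
(* Over each [p] lies the product of two level sets, each with at most [s.-1] points. *)
pose S := [seq (p, t) | p <- P, t <- [seq (q, r) | q <- L alpha p, r <- L beta p]].
apply: (@leq_trans (size S)).
  apply: (@card_fset_le_image _ _ _ (fun t => (t.1.1, (t.1.2, t.2)))).
    by move=> [[p q] r] [[p' q'] r'] _ _ /= [-> -> ->].
  move=> [[p q] r]; rewrite !inE /= -!andbA => /and5P[pP qP rP pq pr].
  apply/allpairsPdep; exists p, (q, r); split=> //.
  by apply/allpairsP; exists (q, r); rewrite !inE /= qP rP.
rewrite size_allpairs_dep mulnC -sum1_size big_distrl sumnE big_map /=.
apply: leq_sum => p _; rewrite mul1n size_allpairs expnS expn1.
have L_le c : c != 0 -> (#|` L c p| <= s.-1)%N.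
  by move=> c0; have := card_level_dot_lt p collP c0; rewrite -/(L c p); case: (s).
by apply: leq_mul; apply: L_le.
Qed.

Lemma card_Pi_set_le_pairs (F : fieldType) (P : {fset 'rV[F]_2})
    (alpha beta : F) :
  beta != 0 -> (#|` Pi_set alpha beta P| <= 2 * #|` P| ^ 2)%N.
Proof.
move=> b0; set X := Pi_set _ _ _.
pose D (t : 'rV[F]_2 * 'rV[F]_2 * 'rV[F]_2) := det2 t.1.2 t.2 == 0.
have -> : X = [fset t in X | D t] `|` [fset t in X | ~~ D t].
  by apply/fsetP => t; rewrite !inE -andb_orr orbN andbT.
apply: leq_trans (leq_card_fsetU _ _) _; rewrite mul2n -addnn -mulnn.
rewrite -(size_allpairs pair P P); apply: leq_add.
  (* Dependent case: [beta *: q = alpha *: r], and [beta] can be cancelled, so [(p, r)] determines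
     [q]. *)
  apply: (@card_fset_le_image _ _ _ (fun t => (t.1.1, t.2))).
    move=> [[p q] r] [[p' q'] r']; rewrite !inE /D /= -!andbA.
    move=> /and5P[_ _ _ /eqP pq /andP[/eqP pr /eqP D0]].
    move=> /and5P[_ _ _ /eqP pq' /andP[/eqP pr' /eqP D0']] [ep er].
    rewrite -ep -er in pq' pr' D0' *; congr (_, _, _); apply: (scalerI b0).
    have := dot_scale_of_det2_eq0 p D0; rewrite pq pr => ->.
    by have := dot_scale_of_det2_eq0 p D0'; rewrite pq' pr' => ->.
  move=> [[p q] r]; rewrite !inE /= -!andbA => /and5P[pP _ rP _ /andP[_ _]].
  by apply/allpairsP; exists (p, r).
(* Independent case: [p] solves a nonsingular linear system given by [(q, r)]. *)
apply: (@card_fset_le_image _ _ _ (fun t => (t.1.2, t.2))).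
  move=> [[p q] r] [[p' q'] r']; rewrite !inE /D /= -!andbA.
  move=> /and5P[_ _ _ /eqP pq /andP[/eqP pr D0]].
  move=> /and5P[_ _ _ /eqP pq' /andP[/eqP pr' _]] [eq er].
  rewrite -eq -er in pq' pr' *; congr (_, _, _).
  by apply: (eq_of_dot D0); rewrite ?pq ?pr.
move=> [[p q] r]; rewrite !inE /= -!andbA => /and5P[_ qP rP _ /andP[_ _]].
by apply/allpairsP; exists (q, r).
Qed.

(** For empty [P] both sides would be 0, so the strict inequality calls for [n_gt0]. *)
Theorem theorem1p1 (F : fieldType) (n s : nat) (P : {fset 'rV[F]_2})
    (alpha beta : F) (n_gt0 : (0 < n)%N) (cardP : #|` P| = n)
    (collP : no_collinear s P) (alpha_neq0 : alpha != 0) (beta_neq0 : beta != 0) :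
  (#|` Pi_set alpha beta P| < minn (2 * s ^ 2 * n) (4 * n ^ 2))%N.
Proof.
have s_gt0 : (0 < s)%N.
  (* Any instance of the strict bound on a level set gives [0 < s]; the vector 0 is an arbitrary
     choice. *)
  exact: leq_ltn_trans (leq0n _) (card_level_dot_lt 0 collP alpha_neq0).
have := card_Pi_set_le_lines collP alpha_neq0 beta_neq0.
have := card_Pi_set_le_pairs P alpha beta_neq0.
rewrite cardP leq_min => le_n le_s; apply/andP; split.
  apply: leq_ltn_trans le_s _; rewrite ltn_pmul2r //.
  by case: s s_gt0 {collP} => // s _ /=; nia.
by apply: leq_ltn_trans le_n _; rewrite ltn_pmul2r ?expn_gt0 ?n_gt0.
Qed.
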